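(* Let $x_* \in \mathrm{dom}(g)$ be a solution of the composite minimization problem $\min_{x\in\mathbb{R}^n} F(x)=\bar f(x)+g(x)$, and let the sequence $(x_k)_{k\ge 0}$ be generated by the Regularized Quasi-Monotone Method (RQM) with positive averaging parameters $(a_k)_{k\ge 0}$ and positive nondecreasing parameters $(\gamma_k)_{k\ge 0}$. Let $A_k=\sum_{\ell=0}^k a_\ell$, $\mu_k = A_k\sigma+\gamma_k\beta$ and $$B_k=\frac12\sum_{\ell=0}^k \frac{a_\ell^2}{\mu_\ell}\,\mathbb{E}\left\|w(x_\ell,\xi_\ell)\right\|_*^2 .$$ Then for all $k\ge 0$: $$\mathbb{E}\left[F(x_k)\right]-F(x_* )\;\le\;\frac{\gamma_k}{A_k}\Psi(x_* )+\frac{B_k}{A_k}.$$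
   Context: Problem: $\bar f,g:\mathbb{R}^n\to\mathbb{R}\cup\{+\infty\}$ are closed convex functions and $\bar f(x)=\mathbb{E}[f(x,\xi)]$, where $f$ is closed and convex in its first argument and $\xi$ is a random sample from a random space $\Xi$. It is assumed that $\mathrm{dom}(f(\cdot,\xi))\subset\mathrm{dom}(g)$ for a.e. $\xi$, and that $\mathrm{dom}(g)$ is closed. $\|\cdot\|$ is an arbitrary fixed norm on $\mathbb{R}^n$ and $\|\cdot\|_*$ is its dual norm. The function $g$ is strongly convex with parameter $\sigma\ge 0$ with respect to $\|\cdot\|$, i.e. $g(\alpha x+(1-\alpha)y)\le \alpha g(x)+(1-\alpha)g(y)-\frac{\sigma}{2}\alpha(1-\alpha)\|x-y\|^2$ for $x,y\in\mathrm{dom}(g)$, $\alpha\in[0,1]$ ($\sigma=0$ is mere convexity). Stochastic subgradients: for every $x\in\mathrm{dom}(g)$ an unbiased finite-variance subgradient estimate $w(x,\xi)$ is available, with $\mathbb{E}[w(x,\xi)]\in\partial\bar f(x)$ (convex subdifferential). Prox-function: $\Psi:\mathbb{R}^n\to\mathbb{R}\cup\{+\infty\}$ is a prox-function for $\mathrm{dom}(g)$, meaning: $\Psi(x)\ge 0$ for all $x\in\mathrm{dom}(g)$; $\Psi$ is strongly convex on $\mathrm{dom}(g)$ with parameter $\beta>0$, i.e. $\Psi(\alpha x+(1-\alpha)y)\le\alpha\Psi(x)+(1-\alpha)\Psi(y)-\frac{\beta}{2}\alpha(1-\alpha)\|x-y\|^2$ for all $x,y\in\mathrm{dom}(g)$,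 $\alpha\in[0,1]$; and the problem $\min_x\{\langle s,x\rangle+g(x)+\gamma\Psi(x)\}$ is (easily) solvable for every $s\in\mathbb{R}^n$ and $\gamma>0$. Parameters: $(a_k)_{k\ge0}$ and $(\gamma_k)_{k\ge0}$ are sequences of positive reals, $\gamma_{k+1}\ge\gamma_k$ for all $k\ge 0$, and $A_k=\sum_{\ell=0}^k a_\ell$. Method (RQM): initialize $x_0=\arg\min_x\{A_0g(x)+\gamma_0\Psi(x)\}$, $s_{-1}=0$. For $k=0,1,2,\dots$: (1) sample $\xi_k\sim\Xi$ (the samples $\xi_0,\xi_1,\dots$ are independent copies of $\xi$); (2) compute $w(x_k,\xi_k)$ and set $s_k=s_{k-1}+a_kw(x_k,\xi_k)$; (3) set $x_k^+=\arg\min_x\{\langle s_k,x\rangle+A_{k+1}g(x)+\gamma_{k+1}\Psi(x)\}$; (4) set $x_{k+1}=\frac{A_k}{A_{k+1}}x_k+\frac{a_{k+1}}{A_{k+1}}x_k^+$. The expectation $\mathbb{E}[F(x_k)]$ is over all the samples. *)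

(* Defs.v *)
From HB Require Export structures.
From mathcomp Require Export all_boot all_order all_algebra finmap.
From mathcomp Require Export all_classical all_reals all_analysis.
From mathcomp Require Export measurable_realfun.
Export numFieldNormedType.Exports.

Set Implicit Arguments.
Unset Strict Implicit.
Unset Printing Implicit Defensive.

Import Order.TTheory GRing.Theory Num.Theory.

Local Open Scope classical_set_scope.
Local Open Scope ring_scope.

Section RealVectorSpace.
Context {R : realType} {n : nat}.
Implicit Types (x y s : 'rV[R]_n) (nrm : 'rV[R]_n -> R) (h : 'rV[R]_n -> \bar R).

Definition dot s x : R := \sum_(i < n) s 0 i * x 0 i.

(* 'rV[R]_n carries the sup norm canonically; an arbitrary norm is therefore
   passed around as a function. Nonnegativity follows from the three axioms. *)
Definition is_norm nrm : Prop :=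
  [/\ forall x y, nrm (x + y) <= nrm x + nrm y,
      forall (c : R) x, nrm (c *: x) = `|c| * nrm x
    & forall x, nrm x = 0 -> x = 0].

Definition dual_norm nrm s : R := sup [set dot s x | x in [set x | nrm x <= 1]].

Definition dom h : set 'rV[R]_n := [set x | (h x < +oo)%E].

Definition epigraph h : set ('rV[R]_n * R) := [set p | (h p.1 <= p.2%:E)%E].

Definition closed_fun h : Prop := closed (epigraph h).

Definition convex_fun h : Prop :=
  forall x y (t : R), dom h x -> dom h y -> 0 <= t <= 1 ->
    (h (t *: x + (1 - t) *: y)%R <= t%:E * h x + (1 - t)%:E * h y)%E.

(* Values may be +oo on D; mathcomp's convention 0 * +oo = 0 makes the
   endpoints t = 0, 1 harmless. *)
Definition strongly_convex_on (D : set 'rV[R]_n) nrm (c : R) h : Prop :=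
  forall x y (t : R), D x -> D y -> 0 <= t <= 1 ->
    (h (t *: x + (1 - t) *: y)%R <=
       t%:E * h x + (1 - t)%:E * h y
       - (c / 2 * t * (1 - t) * nrm (x - y) ^+ 2)%:E)%E.

(* Empty at points outside the effective domain. *)
Definition subdifferential h x : set 'rV[R]_n :=
  [set s | dom h x /\ forall y, (h x + (dot s (y - x)%R)%:E <= h y)%E].

(* Empty when h is identically +oo. *)
Definition argmin h : set 'rV[R]_n :=
  [set x | dom h x /\ forall y, (h x <= h y)%E].

Definition prox_function (g : 'rV[R]_n -> \bar R) nrm (beta : R)
    (Psi : 'rV[R]_n -> \bar R) : Prop :=
  [/\ forall x, Psi x != -oo%E,
      forall x, dom g x -> (0 <= Psi x)%E,
      0 < beta,
      strongly_convex_on (dom g) nrm beta Psi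
    & forall s (c : R), 0 < c ->
        argmin (fun x => (dot s x)%:E + g x + c%:E * Psi x)%E !=set0].

End RealVectorSpace.

(* R^n with its Borel sigma-algebra. *)
Notation borel_rV R n := (g_sigma_algebraType (@open 'rV[R]_n)).

Section Stochastic.
Context {dX dO : measure_display} {Xi : measurableType dX}
  {Omega : measurableType dO} {R : realType} {n : nat}.
Implicit Types (P : probability Xi R) (Q : probability Omega R).

(* If both the positive and the negative part have infinite integral, the
   library integral is -oo; so this value differs from -oo exactly when, for
   measurable f x, the expectation is well defined in R u {+oo}. *)
Definition expected_fun P (f : 'rV[R]_n -> Xi -> \bar R) (x : 'rV[R]_n) : \bar R :=
  (\int[P]_z f x z)%E.

Definition expected_vec P (v : Xi -> 'rV[R]_n) : 'rV[R]_n :=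
  \row_i fine 'E_P[fun z => v z 0%R i]%E.

(* Joint measurability in (x, z) is what makes w(x_k, xi_k) a random vector. *)
Definition stochastic_subgradient P (D : set 'rV[R]_n)
    (fbar : 'rV[R]_n -> \bar R) (w : 'rV[R]_n -> Xi -> 'rV[R]_n) : Prop :=
  [/\ forall i, measurable_fun [set p : borel_rV R n * Xi | D p.1]
        (fun p : borel_rV R n * Xi => w p.1 p.2 0 i),
      forall x, D x -> forall i,
        P.-integrable [set: Xi] (fun z => (w x z 0 i)%:E),
      forall x, D x -> forall i, ('V_P[fun z => w x z 0%R i] < +oo)%E
    & forall x, D x -> subdifferential fbar x (expected_vec P (w x))].

Definition mutually_independent Q (I : choiceType) (X : I -> {mfun Omega >-> Xi})
    : Prop :=
  forall (J : {fset I}) (C : I -> set Xi), (forall i, measurable (C i)) ->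
    Q (\bigcap_(i in [set` J]) (X i @^-1` C i)) =
    (\prod_(i <- J) Q (X i @^-1` C i))%E.

Definition independent_copies P Q (X : nat -> {mfun Omega >-> Xi}) : Prop :=
  mutually_independent Q X /\
  forall k (C : set Xi), measurable C -> distribution Q (X k) C = P C.

Definition Asum (a : nat -> R) (k : nat) : R := \sum_(l < k.+1) a l.

Definition mu_ (a gamma : nat -> R) (sigma beta : R) (k : nat) : R :=
  Asum a k * sigma + gamma k * beta.

(* The dual variable is shifted by one: s k.+1 is the method's s_k and
   s 0 is its s_{-1}. Each argmin is a singleton, by strong convexity of Psi. *)
Record RQM (g Psi : 'rV[R]_n -> \bar R) (a gamma : nat -> R)
    (w : 'rV[R]_n -> Xi -> 'rV[R]_n) (xi : nat -> Omega -> Xi)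
    (s x xplus : nat -> Omega -> 'rV[R]_n) : Prop := {
  rqm_init_s : forall om, s 0%N om = 0 ;
  rqm_init_x : forall om,
    argmin (fun y => (Asum a 0)%:E * g y + (gamma 0)%:E * Psi y)%E (x 0%N om) ;
  rqm_s : forall k om,
    s k.+1 om = s k om + a k *: w (x k om) (xi k om) ;
  rqm_xplus : forall k om,
    argmin (fun y => (dot (s k.+1 om) y)%:E + (Asum a k.+1)%:E * g y
                     + (gamma k.+1)%:E * Psi y)%E (xplus k om) ;
  rqm_x : forall k om,
    x k.+1 om = (Asum a k / Asum a k.+1) *: x k om
                + (a k.+1 / Asum a k.+1) *: xplus k om }.

Definition B_ Q (nrm : 'rV[R]_n -> R) (a gamma : nat -> R) (sigma beta : R)
    (w : 'rV[R]_n -> Xi -> 'rV[R]_n) (xi : nat -> Omega -> Xi)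
    (x : nat -> Omega -> 'rV[R]_n) (k : nat) : \bar R :=
  ((2^-1)%:E * \sum_(l < k.+1)
     (a l ^+ 2 / mu_ a gamma sigma beta l)%:E *
     'E_Q[fun om => (dual_norm nrm (w (x l om) (xi l om)) ^+ 2)%R])%E.

End Stochastic.

(* Main.v *)
(* Put z_0 = x_0 and z_(k+1) = x_k^+, so that z_k minimizes
   <s, y> + A_k g(y) + gamma_k Psi(y) at the current dual variable s. This
   objective is mu_k-strongly convex, so its minimal value grows by at least
   a_k <w_k, z_k> - a_k^2 ||w_k||_*^2 / (2 mu_k) when a_k w_k is added to s.
   Since A_k x_k = A_(k-1) x_(k-1) + a_k z_k, summing these estimates and
   telescoping the subgradient inequalities for G_k = E[w(x_k, .)] yields,
   for every sample path,
     A_k (F(x_k) - F(x_* )) <= gamma_k Psi(x_* )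
       + sum_l a_l^2 ||w_l||_*^2 / (2 mu_l) + sum_l a_l <G_l - w_l, z_l - x_*>.
   The last sum has mean zero: z_l is a Lipschitz function of the dual variable,
   hence square integrable and measurable with respect to xi_0, ..., xi_(l-1),
   which are independent of xi_l. If B_k or Psi(x_* ) is infinite the bound is
   trivial. *)

Require Import Defs.
From mathcomp Require Import ring lra.

Import Order.TTheory GRing.Theory Num.Theory.

Set Implicit Arguments.
Unset Strict Implicit.
Unset Printing Implicit Defensive.

Local Open Scope classical_set_scope.
Local Open Scope ring_scope.

Lemma lipschitz_continuous_bound {R : realType} (V W : normedModType R)
    (f : V -> W) (K : R) :
  (forall x y, `|f x - f y| <= K * `|x - y|) -> continuous f.
Proof.
move=> fK x; apply/cvgrPdist_le => /= e e0.
have K1 : 0 < `|K| + 1 by rewrite ltr_wpDl.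
have d0 : 0 < e / (`|K| + 1) by rewrite divr_gt0.
near=> y.
have xy : `|x - y| <= e / (`|K| + 1).
  by near: y; apply: cvgr_dist_le => //; exact: cvg_id.
apply: le_trans (fK _ _) _; apply: (@le_trans _ _ ((`|K| + 1) * `|x - y|)).
  by rewrite ler_wpM2r// (le_trans (ler_norm _))// lerDl.
by rewrite mulrC -ler_pdivlMr.
Unshelve. all: by end_near. Qed.

(** * The dual norm and equivalence of norms *)

Section Dot.
Context {R : realType} {n : nat}.
Implicit Types (s x y : 'rV[R]_n).

Lemma dotDl s1 s2 x : dot (s1 + s2) x = dot s1 x + dot s2 x.
Proof. by rewrite /dot -big_split; apply: eq_bigr => i _; rewrite mxE mulrDl. Qed.

Lemma dotDr s x y : dot s (x + y) = dot s x + dot s y.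
Proof. by rewrite /dot -big_split; apply: eq_bigr => i _; rewrite mxE mulrDr. Qed.

Lemma dotZl c s x : dot (c *: s) x = c * dot s x.
Proof. by rewrite /dot mulr_sumr; apply: eq_bigr => i _; rewrite mxE mulrA. Qed.

Lemma dotZr c s x : dot s (c *: x) = c * dot s x.
Proof. by rewrite /dot mulr_sumr; apply: eq_bigr => i _; rewrite mxE mulrCA. Qed.

Lemma dot0l x : dot 0 x = 0.
Proof. by rewrite -(scale0r (0 : 'rV[R]_n)) dotZl mul0r. Qed.

Lemma dotNr s x : dot s (- x) = - dot s x.
Proof. by rewrite -scaleN1r dotZr mulN1r. Qed.

Lemma dotBr s x y : dot s (x - y) = dot s x - dot s y.
Proof. by rewrite dotDr dotNr. Qed.

Lemma dotBl s1 s2 x : dot (s1 - s2) x = dot s1 x - dot s2 x.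
Proof. by rewrite dotDl -scaleN1r dotZl mulN1r. Qed.

Lemma dot_delta s i : dot s (delta_mx 0 i) = s 0 i.
Proof.
rewrite /dot (bigD1 i)//= mxE !eqxx mulr1 big1 ?addr0// => j ji.
by rewrite mxE (negbTE ji) andbF mulr0.
Qed.

End Dot.

Lemma ler_coord_norm {R : realType} n (x : 'rV[R]_n) i : `|x 0 i| <= `|x|.
Proof.
rewrite [leRHS]/Num.norm /= mx_normrE; apply/bigmax_geP; right => /=.
by exists (0, i).
Qed.

Lemma sum_coord_le_norm {R : realType} n (x : 'rV[R]_n) :
  \sum_(i < n) `|x 0 i| <= n%:R * `|x|.
Proof.
rewrite -[n in n%:R]card_ord -sum1_card natr_sum mulr_suml.
by apply: ler_sum => i _; rewrite mul1r ler_coord_norm.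
Qed.

Section Norms.
Context {R : realType} {n : nat}.
Variable nrm : 'rV[R]_n -> R.
Hypothesis nrmP : is_norm nrm.
Implicit Types (s x y : 'rV[R]_n).

Lemma nrmD x y : nrm (x + y) <= nrm x + nrm y.
Proof. by case: nrmP. Qed.

Lemma nrmZ c x : nrm (c *: x) = `|c| * nrm x.
Proof. by case: nrmP. Qed.

Lemma nrm0 : nrm 0 = 0.
Proof. by rewrite -(scale0r 0) nrmZ normr0 mul0r. Qed.

Lemma nrmN x : nrm (- x) = nrm x.
Proof. by rewrite -scaleN1r nrmZ normrN1 mul1r. Qed.

Lemma nrmB x y : nrm (x - y) = nrm (y - x).
Proof. by rewrite -nrmN opprB. Qed.

Lemma nrm_ge0 x : 0 <= nrm x.
Proof. by have := nrmD x (- x); rewrite subrr nrm0 nrmN; lra. Qed.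

Lemma nrm_eq0 x : nrm x = 0 -> x = 0.
Proof. by case: nrmP => _ _; exact. Qed.

Lemma ler_nrm_sum I (r : seq I) (F : I -> 'rV[R]_n) :
  nrm (\sum_(i <- r) F i) <= \sum_(i <- r) nrm (F i).
Proof.
elim: r => [|i r ih]; first by rewrite !big_nil nrm0.
by rewrite !big_cons (le_trans (nrmD _ _))// lerD2l.
Qed.

(** Expand x in the standard basis; the constant is the sum of the norms of the basis vectors. *)
Lemma nrm_le_sup : exists2 K : R, 0 <= K & forall x, nrm x <= K * `|x|.
Proof.
exists (\sum_(i < n) nrm (delta_mx 0 i)).
  by apply: sumr_ge0 => i _; exact: nrm_ge0.
move=> x; rewrite {1}(row_sum_delta x) (le_trans (ler_nrm_sum _ _))// mulr_suml.
apply: ler_sum => i _; rewrite nrmZ mulrC ler_wpM2l ?nrm_ge0//.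
exact: ler_coord_norm.
Qed.

Lemma nrm_continuous : continuous nrm.
Proof.
have [K K0 HK] := nrm_le_sup.
apply: (@lipschitz_continuous_bound _ _ _ _ K) => x y.
apply: le_trans (HK _).
have := nrmD (x - y) y; have := nrmD (y - x) x.
rewrite !subrK (nrmB y x) ler_norml => ? ?.
by apply/andP; split; lra.
Qed.

(* Compactness of the unit sphere of the sup norm. *)
Lemma sup_le_nrm : exists2 K : R, 0 < K & forall x, `|x| <= K * nrm x.
Proof.
pose S := [set x : 'rV[R]_n | `|x| = 1].
have [[x0 Sx0]|S0] := pselect (S !=set0); last first.
  (* An empty unit sphere leaves only the zero vector, so any constant works. *)
  exists 1 => // x; rewrite mul1r.
  have [->|x0] := eqVneq x 0; first by rewrite normr0 nrm_ge0.
  exfalso; apply: S0; exists (`|x|^-1 *: x).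
  by rewrite /S /= normrZ normfV normr_id mulVf ?normr_eq0.
have cS : compact S.
  apply: bounded_closed_compact.
    exists 1; split; first exact: num_real.
    by move=> M M1 x /= ->; exact: ltW.
  rewrite (_ : S = (fun x : 'rV[R]_n => `|x|) @^-1` [set 1])//.
  by apply: closed_comp; [move=> x _; exact: norm_continuous|exact: closed_eq].
have [c cS' cmin] := @EVT_min_rV R n nrm S (ex_intro _ x0 Sx0) cS
  (continuous_subspaceT nrm_continuous).
have c0 : 0 < nrm c.
  rewrite lt_def nrm_ge0 andbT; apply/eqP => /nrm_eq0 c0.
  by move: cS'; rewrite inE /S /= c0 normr0 => /esym/eqP; rewrite oner_eq0.
exists (nrm c)^-1; first by rewrite invr_gt0.
move=> x; have [->|x1] := eqVneq x 0; first by rewrite normr0 nrm0 mulr0.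
have nx : 0 < `|x| by rewrite normr_gt0.
have : nrm c <= nrm (`|x|^-1 *: x).
  by apply: cmin; rewrite inE /S /= normrZ normfV normr_id mulVf ?normr_eq0.
rewrite nrmZ normfV normr_id ler_pdivlMl// => H.
by rewrite -ler_pdivrMl ?invr_gt0// invrK mulrC.
Qed.

(** [sup] defaults to 0 on sets without a supremum; boundedness, by comparison with the sup norm,
    makes [dual_norm] a true supremum. *)
Lemma dual_norm_has_sup s :
  has_sup [set dot s x | x in [set x | nrm x <= 1]].
Proof.
split; first by exists (dot s 0), 0 => //=; rewrite nrm0.
have [K K0 HK] := sup_le_nrm.
exists (\sum_(i < n) `|s 0 i| * K) => _ [x /= x1 <-].
apply: ler_sum => i _; apply: le_trans (ler_norm _) _.
rewrite normrM ler_wpM2l//; apply: le_trans (ler_coord_norm _ _) _.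
by apply: le_trans (HK _) _; rewrite -[leRHS]mulr1 ler_pM2l.
Qed.

Lemma dual_norm_ge0 s : 0 <= dual_norm nrm s.
Proof.
apply: ub_le_sup; first by case: (dual_norm_has_sup s).
by exists 0; rewrite /= ?nrm0// -(scale0r 0) dotZr mul0r.
Qed.

Lemma dot_le_dual_norm s x : dot s x <= dual_norm nrm s * nrm x.
Proof.
have [->|x0] := eqVneq x 0.
  by rewrite nrm0 mulr0 -(scale0r 0) dotZr mul0r.
have nx : 0 < nrm x.
  by rewrite lt_def nrm_ge0 andbT; apply: contra x0 => /eqP/nrm_eq0 ->.
rewrite -ler_pdivrMr// mulrC -dotZr.
apply: ub_le_sup; first by case: (dual_norm_has_sup s).
exists ((nrm x)^-1 *: x) => //=.
by rewrite nrmZ normfV gtr0_norm// mulVf// gt_eqF.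
Qed.

Lemma normr_dot_le s x : `|dot s x| <= dual_norm nrm s * nrm x.
Proof.
rewrite ler_norml dot_le_dual_norm andbT lerNl -dotNr -(nrmN x).
exact: dot_le_dual_norm.
Qed.

Lemma dual_norm_triangle s t :
  dual_norm nrm (s + t) <= dual_norm nrm s + dual_norm nrm t.
Proof.
apply: ge_sup; first by case: (dual_norm_has_sup (s + t)).
move=> _ [x /= x1 <-]; rewrite dotDl.
by rewrite lerD// (le_trans (dot_le_dual_norm _ _))// -[leRHS]mulr1
  ler_wpM2l// dual_norm_ge0.
Qed.

Lemma dual_norm_le : exists2 K : R, 0 < K &
  forall s, dual_norm nrm s <= K * \sum_(i < n) `|s 0 i|.
Proof.
have [K K0 HK] := sup_le_nrm; exists K => // s.
apply: ge_sup; first by case: (dual_norm_has_sup s).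
move=> _ [x /= x1 <-]; rewrite mulr_sumr.
apply: ler_sum => i _; apply: le_trans (ler_norm _) _.
rewrite normrM mulrC ler_wpM2r//; apply: le_trans (ler_coord_norm _ _) _.
by apply: le_trans (HK _) _; rewrite -[leRHS]mulr1 ler_pM2l.
Qed.

Lemma ler_coord_dual_norm s i :
  `|s 0 i| <= dual_norm nrm s * nrm (delta_mx 0 i).
Proof. by rewrite -dot_delta; exact: normr_dot_le. Qed.

Lemma dual_norm_continuous : continuous (dual_norm nrm).
Proof.
have [K K0 HK] := dual_norm_le.
pose M := K * n%:R + 1.
have M0 : 0 < M by rewrite ltr_wpDl// mulr_ge0// ltW.
have HM s : dual_norm nrm s <= M * `|s|.
  apply: le_trans (HK s) _; apply: (@le_trans _ _ (K * (n%:R * `|s|))).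
    by rewrite ler_pM2l// sum_coord_le_norm.
  by rewrite mulrA ler_wpM2r// lerDl.
apply: (@lipschitz_continuous_bound _ _ _ _ M) => x y.
have := dual_norm_triangle (x - y) y; have := dual_norm_triangle (y - x) x.
have := HM (x - y); have := HM (y - x).
rewrite !subrK (distrC y x) ler_norml => ? ? ? ?.
by apply/andP; split; lra.
Qed.

End Norms.

(** * Minimizers of strongly convex functions *)

Section Minimizers.
Context {R : realType} {n : nat}.
Variable nrm : 'rV[R]_n -> R.
Hypothesis nrmP : is_norm nrm.
Implicit Types (s x y p q : 'rV[R]_n) (E : set 'rV[R]_n) (h : 'rV[R]_n -> R).

(** Real-valued counterpart of [argmin], with the effective domain as an explicit set, so that the
    estimates below are real arithmetic. *)
Definition minimizes E h p := E p /\ forall y, E y -> h p <= h y.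

Definition convex_domain E := forall x y (t : R), E x -> E y -> 0 <= t <= 1 ->
  E (t *: x + (1 - t) *: y).

Definition strongly_convex_real E (c : R) h :=
  forall x y (t : R), E x -> E y -> 0 <= t <= 1 ->
    h (t *: x + (1 - t) *: y) <=
      t * h x + (1 - t) * h y - c / 2 * t * (1 - t) * nrm (x - y) ^+ 2.

Lemma strongly_convex_lin E (a b sigma beta : R) g h : 0 <= a -> 0 <= b ->
  strongly_convex_real E sigma g -> strongly_convex_real E beta h ->
  strongly_convex_real E (a * sigma + b * beta) (fun y => a * g y + b * h y).
Proof.
move=> a0 b0 gE hE x y t Ex Ey t01.
have := ler_wpM2l a0 (gE x y t Ex Ey t01).
have := ler_wpM2l b0 (hE x y t Ex Ey t01).
move: (nrm _ ^+ 2) (g (_ + _)) (h (_ + _)) => N u v H1 H2.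
apply: le_trans (lerD H2 H1) _.
by rewrite le_eqVlt; apply/orP; left; apply/eqP; field.
Qed.

(** Compare p with t q + (1 - t) p: minimality and strong convexity, divided by t, give (1 - t) N <=
    d for arbitrarily small t. *)
Lemma minimizer_growth E (mu : R) h s p q : 0 <= mu ->
  convex_domain E -> strongly_convex_real E mu h ->
  minimizes E (fun y => dot s y + h y) p -> E q ->
  dot s p + h p + mu / 2 * nrm (q - p) ^+ 2 <= dot s q + h q.
Proof.
move=> mu0 cE hE [Ep pmin] Eq.
set N := mu / 2 * _; set d := dot s q + h q - (dot s p + h p).
have N0 : 0 <= N by rewrite mulr_ge0 ?sqr_ge0// divr_ge0.
have dN t : 0 < t < 1 -> (1 - t) * N <= d.
  move=> t01; have t01' : 0 <= t <= 1 by lra.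
  have := pmin _ (cE _ _ t Eq Ep t01').
  have := hE _ _ t Eq Ep t01'.
  rewrite dotDr !dotZr => H1 H2.
  have t0 : 0 < t by lra.
  rewrite -(ler_pM2l t0) /d.
  have -> : t * ((1 - t) * N) = mu / 2 * t * (1 - t) * nrm (q - p) ^+ 2.
    by rewrite /N; ring.
  nra.
rewrite -subr_ge0; have -> : dot s q + h q - (dot s p + h p + N) = d - N.
  by rewrite /d; ring.
rewrite subr_ge0 leNgt; apply/negP => dltN.
have half : 0 < (2^-1 : R) < 1 by lra.
have d0 : 0 <= d by apply: le_trans (dN _ half); rewrite mulr_ge0//; lra.
have Np : 0 < N by exact: le_lt_trans dltN.
(* This t makes (1 - t) N the midpoint of d and N, which exceeds d when d < N. *)
have t01 : 0 < (N - d) / (2 * N) < 1.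
  apply/andP; split; first by apply: divr_gt0; [rewrite subr_gt0|apply: mulr_gt0].
  by rewrite ltr_pdivrMr; [lra|apply: mulr_gt0].
have := dN _ t01.
have -> : (1 - (N - d) / (2 * N)) * N = (N + d) / 2.
  by field; rewrite gt_eqF.
lra.
Qed.

(** Adding the growth estimates at both minimizers gives mu ||p - p'||^2 <= <s - s', p' - p>; the
    dual norm bounds the right side. *)
Lemma minimizer_lipschitz E (mu : R) h s s' p p' : 0 < mu ->
  convex_domain E -> strongly_convex_real E mu h ->
  minimizes E (fun y => dot s y + h y) p ->
  minimizes E (fun y => dot s' y + h y) p' ->
  nrm (p - p') <= dual_norm nrm (s - s') / mu.
Proof.
move=> mu0 cE hE sp sp'.
have := minimizer_growth (ltW mu0) cE hE sp (proj1 sp').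
have := minimizer_growth (ltW mu0) cE hE sp' (proj1 sp).
rewrite (nrmB nrmP p') => H1 H2.
have := dot_le_dual_norm nrmP (s - s') (p' - p).
rewrite (nrmB nrmP p') dotBl !dotBr.
have [->|nz] := eqVneq (nrm (p - p')) 0.
  by rewrite divr_ge0 ?(dual_norm_ge0 nrmP)// ltW.
have np : 0 < nrm (p - p') by rewrite lt_def nz nrm_ge0.
move=> H3; rewrite ler_pdivlMr// -(ler_pM2r np).
have -> : nrm (p - p') * mu * nrm (p - p') = mu * nrm (p - p') ^+ 2 by ring.
lra.
Qed.

End Minimizers.

(** * The deterministic estimate along one sample path *)

Section RegularizedQuasiMonotonePath.
Context {R : realType} {n : nat}.
Variable nrm : 'rV[R]_n -> R.
Hypothesis nrmP : is_norm nrm.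
Variables (E : set 'rV[R]_n) (f g Psi : 'rV[R]_n -> R) (sigma beta : R).
Hypotheses (cE : convex_domain E) (sigma0 : 0 <= sigma) (beta0 : 0 < beta).
Hypotheses (gE : strongly_convex_real nrm E sigma g)
  (PsiE : strongly_convex_real nrm E beta Psi)
  (Psi0 : forall y, E y -> 0 <= Psi y).
Variables (a gamma : nat -> R).
Hypotheses (a0 : forall k, 0 < a k) (gamma0 : forall k, 0 < gamma k)
  (gammaS : forall k, gamma k <= gamma k.+1).

Lemma Asum0 : Asum a 0 = a 0%N.
Proof. by rewrite /Asum big_ord1. Qed.

Lemma AsumS k : Asum a k.+1 = Asum a k + a k.+1.
Proof. by rewrite /Asum big_ord_recr. Qed.

Lemma Asum_gt0 k : 0 < Asum a k.
Proof. by elim: k => [|k ih]; rewrite ?Asum0// AsumS addr_gt0. Qed.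

Lemma mu_gt0 k : 0 < mu_ a gamma sigma beta k.
Proof.
by rewrite ltr_wpDl ?mulr_gt0 ?gamma0// mulr_ge0// ltW// Asum_gt0.
Qed.

Definition prox_objective k (s y : 'rV[R]_n) : R :=
  dot s y + (Asum a k * g y + gamma k * Psi y).

Lemma prox_objective_strongly_convex k : strongly_convex_real nrm E
  (mu_ a gamma sigma beta k) (fun y => Asum a k * g y + gamma k * Psi y).
Proof.
by apply: strongly_convex_lin => //; apply: ltW => //; exact: Asum_gt0.
Qed.

Variables (s x z w G : nat -> 'rV[R]_n) (xs : 'rV[R]_n).
Hypothesis Exs : E xs.
Hypotheses (s0 : s 0%N = 0) (sS : forall k, s k.+1 = s k + a k *: w k).
Hypothesis zP : forall k, minimizes E (prox_objective k (s k)) (z k).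
Hypotheses (x0 : x 0%N = z 0%N)
  (xS : forall k, x k.+1 =
     (Asum a k / Asum a k.+1) *: x k + (a k.+1 / Asum a k.+1) *: z k.+1).
Hypothesis Gsub : forall k y, E y -> f (x k) + dot (G k) (y - x k) <= f y.

Let ratio k : a k.+1 / Asum a k.+1 = 1 - Asum a k / Asum a k.+1.
Proof.
have := Asum_gt0 k.+1; rewrite AsumS => A0.
by field; rewrite gt_eqF.
Qed.

Let ratio01 k : 0 <= Asum a k / Asum a k.+1 <= 1.
Proof.
have A1 := Asum_gt0 k.+1; have A0 := Asum_gt0 k.
apply/andP; split; first by rewrite divr_ge0 ?ltW.
by rewrite ler_pdivrMr// mul1r AsumS lerDl ltW.
Qed.

Lemma iterate_dom k : E (x k).
Proof.
elim: k => [|k ih]; first by rewrite x0; case: (zP 0).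
rewrite xS ratio; apply: cE => //; first by case: (zP k.+1).
Qed.

(** Convexity of [g] along the averaging rule, multiplied by A_(k+1); the quadratic gain is dropped
    here. *)
Lemma averaging_step k :
  Asum a k.+1 * g (x k.+1) <= Asum a k * g (x k) + a k.+1 * g (z k.+1).
Proof.
have A1 := Asum_gt0 k.+1.
have Ez : E (z k.+1) by case: (zP k.+1).
have := gE (iterate_dom k) Ez (ratio01 k); rewrite -ratio -xS => H.
have : g (x k.+1) <=
    Asum a k / Asum a k.+1 * g (x k) + a k.+1 / Asum a k.+1 * g (z k.+1).
  apply: le_trans H _; rewrite gerBl.
  rewrite mulr_ge0 ?sqr_ge0// !mulr_ge0 ?invr_ge0//; apply: ltW => //.
  exact: Asum_gt0.
rewrite -(ler_pM2l A1) => /le_trans; apply.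
by rewrite le_eqVlt; apply/orP; left; apply/eqP; field; rewrite gt_eqF.
Qed.

Let q l := 2^-1 * (a l ^+ 2 / mu_ a gamma sigma beta l *
  dual_norm nrm (w l) ^+ 2).

(** Quadratic growth away from [z k] absorbs the term a_k <w_k, z_k - y>. The point y stays free: it
    is z_(k+1) in the induction below and [xs] in the final comparison. *)
Lemma dual_step k y : E y ->
  prox_objective k (s k) (z k) - q k + a k * dot (w k) (z k) <=
  prox_objective k (s k.+1) y.
Proof.
move=> Ey; have mu0 := mu_gt0 k.
have := minimizer_growth (ltW mu0) cE (prox_objective_strongly_convex k)
  (zP k) Ey.
rewrite -/(prox_objective k (s k) (z k)) -/(prox_objective k (s k) y) => H.
have -> : prox_objective k (s k.+1) y =
    prox_objective k (s k) y + a k * dot (w k) y.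
  by rewrite /prox_objective sS dotDl dotZl; ring.
have := dot_le_dual_norm nrmP (w k) (z k - y).
rewrite (nrmB nrmP (z k)) dotBr => /(ler_wpM2l (ltW (a0 k))).
move: H mu0; rewrite /q.
move: (mu_ _ _ _ _ _) (nrm _) (dual_norm _ _) => m N D H1 m0 H2.
(* AM-GM: [a D N <= (a D)^2 / (2 m) + m N^2 / 2] *)
have : 0 <= (a k * D / m - N) ^+ 2 * (m / 2).
  by rewrite mulr_ge0 ?sqr_ge0// divr_ge0// ltW.
have -> : (a k * D / m - N) ^+ 2 * (m / 2) =
   2^-1 * (a k ^+ 2 / m * D ^+ 2) - a k * (D * N) + m / 2 * N ^+ 2.
  by field; rewrite gt_eqF.
lra.
Qed.

Lemma dual_lower_bound k :
  Asum a k * g (x k) + \sum_(l < k) (a l * dot (w l) (z l) - q l) <=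
  prox_objective k (s k) (z k).
Proof.
elim: k => [|k ih].
  rewrite big_ord0 addr0 x0 /prox_objective s0 dot0l add0r lerDl.
  by rewrite mulr_ge0 ?Psi0 ?ltW//; case: (zP 0).
have Ez : E (z k.+1) by case: (zP k.+1).
have := dual_step k Ez; have := averaging_step k.
rewrite big_ord_recr /=.
(* Passing to the weights of stage k+1 adds a_(k+1) g(z_(k+1)), which feeds [averaging_step], and a
   multiple of [Psi] that is nonnegative because [gamma] is nondecreasing. *)
have -> : prox_objective k.+1 (s k.+1) (z k.+1) =
  prox_objective k (s k.+1) (z k.+1) + a k.+1 * g (z k.+1)
  + (gamma k.+1 - gamma k) * Psi (z k.+1).
  by rewrite /prox_objective AsumS; ring.
have : 0 <= (gamma k.+1 - gamma k) * Psi (z k.+1).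
  by rewrite mulr_ge0 ?subr_ge0 ?Psi0.
lra.
Qed.

(** In the induction the subgradient at x_(k+1) is tested against x_k with weight A_k and against
    [xs] with weight a_(k+1); the averaging rule merges the two displacements into a_(k+1) (z_(k+1)
    - xs). *)
Lemma primal_telescope k :
  Asum a k * (f (x k) - f xs) <=
  \sum_(l < k.+1) a l * dot (G l) (z l - xs).
Proof.
elim: k => [|k ih].
  rewrite big_ord1 Asum0 ler_pM2l// -x0.
  have := Gsub 0 Exs; rewrite -(opprB (x 0%N) xs) dotNr; lra.
rewrite big_ord_recr /=.
have H1 := ler_wpM2l (ltW (Asum_gt0 k)) (Gsub k.+1 (iterate_dom k)).
have H2 := ler_wpM2l (ltW (a0 k.+1)) (Gsub k.+1 Exs).
have zE : a k.+1 *: z k.+1 = Asum a k.+1 *: x k.+1 - Asum a k *: x k.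
  rewrite xS scalerDr !scalerA !(mulrC (Asum a k.+1)) !divfK ?gt_eqF ?Asum_gt0//.
  by rewrite addrC addKr.
have : a k.+1 * dot (G k.+1) (z k.+1 - xs) =
  - (Asum a k * dot (G k.+1) (x k - x k.+1) + a k.+1 * dot (G k.+1) (xs - x k.+1)).
  rewrite -dotZr scalerBr zE !dotBr !dotZr AsumS; ring.
move: H1 H2; rewrite AsumS; lra.
Qed.

(** [dual_step] at [xs] bounds the prox objective from above and [dual_lower_bound] bounds it from
    below; this controls the [g] part, and [primal_telescope] controls the [f] part. *)
Lemma pathwise_bound k :
  Asum a k * (f (x k) + g (x k)) <= Asum a k * (f xs + g xs)
    + gamma k * Psi xs
    + 2^-1 * \sum_(l < k.+1) a l ^+ 2 / mu_ a gamma sigma beta l *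
        dual_norm nrm (w l) ^+ 2
    + \sum_(l < k.+1) a l * dot (G l - w l) (z l - xs).
Proof.
have := dual_step k Exs; have := dual_lower_bound k; have := primal_telescope k.
have sE : dot (s k.+1) xs = \sum_(l < k.+1) a l * dot (w l) xs.
  elim: k.+1 => [|m ih]; first by rewrite s0 dot0l big_ord0.
  by rewrite sS dotDl dotZl big_ord_recr /= ih.
rewrite /prox_objective sE.
have -> : \sum_(l < k.+1) a l * dot (G l - w l) (z l - xs) =
  \sum_(l < k.+1) a l * dot (G l) (z l - xs)
  - \sum_(l < k.+1) a l * dot (w l) (z l) + \sum_(l < k.+1) a l * dot (w l) xs.
  rewrite -sumrB -big_split /=; apply: eq_bigr => l _.
  by rewrite dotBl !dotBr; ring.
have -> : 2^-1 * \sum_(l < k.+1) a l ^+ 2 / mu_ a gamma sigma beta l *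
    dual_norm nrm (w l) ^+ 2 = \sum_(l < k.+1) q l by rewrite mulr_sumr.
rewrite sumrB !(big_ord_recr k) /=.
lra.
Qed.

End RegularizedQuasiMonotonePath.

(** * Borel sets of R^n *)

Section BorelRowVectors.
Context {R : realType} {n : nat}.

Lemma open_borel_rV (U : set 'rV[R]_n) :
  open U -> measurable (U : set (borel_rV R n)).
Proof. by move=> oU; exact: sub_sigma_algebra. Qed.

Lemma closed_borel_rV (U : set 'rV[R]_n) :
  closed U -> measurable (U : set (borel_rV R n)).
Proof.
move=> cU; rewrite -[X in measurable X]setCK; apply: measurableC.
by apply: open_borel_rV; exact: closed_openC.
Qed.

Lemma continuous_borel_rV_fun m (f : 'rV[R]_n -> 'rV[R]_m) : continuous f ->
  measurable_fun [set: borel_rV R n] (f : borel_rV R n -> borel_rV R m).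
Proof.
move=> /continuousP cf; apply: (@measurability _ _ (borel_rV R n) (borel_rV R m) setT f
  (@open 'rV[R]_m)) => //.
by move=> _ [B oB <-]; rewrite setTI; apply: open_borel_rV; exact: cf.
Qed.

Lemma continuous_borel_fun (f : 'rV[R]_n -> R) : continuous f ->
  measurable_fun [set: borel_rV R n] (f : borel_rV R n -> R).
Proof.
move=> /continuousP cf; apply: (measurability _ (RGenOpens.measurableE R)).
move=> _ [_ [a [b ->] <-]]; rewrite setTI.
by apply: open_borel_rV; apply: cf; exact: interval_open.
Qed.

Lemma coord_borel_fun (i : 'I_n) :
  measurable_fun [set: borel_rV R n] (fun x : borel_rV R n => (x : 'rV[R]_n) 0 i).
Proof. by apply: continuous_borel_fun; exact: coord_continuous. Qed.

Context d (T : measurableType d) (h : T -> 'rV[R]_n).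
Hypothesis mh : forall i, measurable_fun [set: T] (fun t => h t 0 i).

(* Every open set is a countable union of rational boxes. *)
Lemma measurable_fun_borel_rV :
  measurable_fun [set: T] (h : T -> borel_rV R n).
Proof.
apply: (@measurability _ _ _ (borel_rV R n) setT h (@open 'rV[R]_n)) => //.
move=> _ [U oU <-]; rewrite setTI.
(* Boxes have rational centre and radius; those that leave U are replaced by the empty set, so that
   the union runs over a countable type. *)
pose box (p : 'rV[rat]_n * rat) :=
  [set y : 'rV[R]_n | forall i, `|ratr (p.1 0 i) - y 0 i| < ratr p.2].
pose F p := if `[< box p `<=` U >] then h @^-1` box p else set0.
have -> : h @^-1` U = \bigcup_p F p.
  apply/seteqP; split=> [t /= Uht|t [p _]]; last first.
    by rewrite /F; case: asboolP => // pU /pU.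
  have /nbhs_ballP[e /= e0 eU] : nbhs (h t) U by exact: open_nbhs_nbhs.
  (* With a radius below e/2, any two points of a box differ by less than e in every coordinate. *)
  have /rat_in_itvoo[r] : 0 < e / 2 by rewrite divr_gt0.
  rewrite in_itv /= => /andP[r0 re].
  have q_ i : exists q : rat, `|ratr q - h t 0 i| < ratr r :> R.
    have /rat_in_itvoo[q] : h t 0 i < h t 0 i + ratr r by rewrite ltrDl.
    rewrite in_itv /= => /andP[q1 q2]; exists q.
    by rewrite ger0_norm ?subr_ge0 1?ltW// ltrBlDl.
  have [q qP] := choice q_.
  exists (\row_i q i, r) => //; rewrite /F.
  have tbox : box (\row_i q i, r) (h t) by move=> i; rewrite mxE.
  case: asboolP => // -[] y ybox; apply: eU; split=> // i j.
  rewrite (ord1 i) /ball /=; have := ybox j; have := tbox j.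
  rewrite /= mxE => H1 H2.
  have -> : h t 0 j - y 0 j = (ratr (q j) - y 0 j) - (ratr (q j) - h t 0 j).
    by ring.
  apply: le_lt_trans (ler_normB _ _) _.
  have : ratr r + ratr r < e by lra.
  by apply: lt_trans; rewrite ltrD.
apply: countable_bigcupT_measurable; first exact: countableP.
move=> p; rewrite /F; case: ifPn => // _.
have -> : h @^-1` box p =
    \bigcap_i ((fun t => h t 0 i) @^-1` (ball (ratr (p.1 0 i) : R) (ratr p.2))).
  by apply/seteqP; split=> t /= H; [move=> i _; exact: H|move=> i; exact: H].
apply: fin_bigcap_measurable => // i _.
by rewrite -[X in measurable X]setTI; apply: mh => //; exact: measurable_ball.
Qed.

End BorelRowVectors.

(** * Independence of the past *)

Section IndependentFubini.
Context d1 d2 dO (T1 : measurableType d1) (T2 : measurableType d2)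
  (Omega : measurableType dO) (R : realType).
Variables (Q : probability Omega R) (P : probability T2 R).
Variables (H : {mfun Omega >-> T1}) (X : {mfun Omega >-> T2}).
Hypothesis HX : forall A B, measurable A -> measurable B ->
  Q (H @^-1` A `&` X @^-1` B) = (Q (H @^-1` A) * P B)%E.
Variable phi : T1 * T2 -> \bar R.
Hypothesis mphi : measurable_fun setT phi.
Hypothesis iphi : Q.-integrable setT (fun om => phi (H om, X om)).

Let mHX : measurable_fun setT (fun om => (H om, X om)).
Proof. exact: measurable_fun_pair. Qed.

Let HXm : {mfun Omega >-> (T1 * T2)%type} :=
  HB.pack (fun om => (H om, X om)) (isMeasurableFun.Build _ _ _ _ _ mHX).

(** Independence on rectangles determines the joint law of (H, X) as a product measure, which opens
    the way to Fubini's theorem. *)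
Let lawE A : measurable A ->
  (distribution Q H \x P)%E A = distribution Q HXm A.
Proof. by move=> mA; apply: product_measure_unique => // B C mB mC; exact: HX. Qed.

Let iphi' : (distribution Q HXm).-integrable setT phi.
Proof. by apply: integrable_pushforward. Qed.

Let iphi'' : (distribution Q H \x P)%E.-integrable setT phi.
Proof.
have /integrableP[_ ioo] := iphi'; apply/integrableP; split => //.
rewrite (eq_measure_integral (distribution Q HXm)) // => A mA _.
exact: lawE.
Qed.

Lemma integrable_indep :
  Q.-integrable setT (fun om => \int[P]_z phi (H om, z))%E.
Proof.
have /integrableP[mF iF] := integrable_fubini_F iphi''.
apply/integrableP; split; first exact: measurableT_comp mF _.
move: iF.
rewrite (@ge0_integral_distribution _ _ _ _ _ Q H
  (fun t => `|fubini_F P phi t|)%E)//.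
exact: measurableT_comp.
Qed.

(** Transfer to the product law, integrate out the second coordinate, and transfer back: X is
    replaced by a fresh sample of law P. *)
Lemma integral_indep :
  (\int[Q]_om phi (H om, X om) = \int[Q]_om \int[P]_z phi (H om, z))%E.
Proof.
have := integral12_prod_meas1 iphi''.
have imF := integrable_fubini_F iphi''.
rewrite integral_distribution; [|exact: measurable_int imF|exact: integrable_indep].
rewrite /comp /= => ->; rewrite (eq_measure_integral (distribution Q HXm)).
  by rewrite integral_distribution.
by move=> A mA _; exact: lawE.
Qed.

End IndependentFubini.

Section Past.
Context d dO (Xi : measurableType d) (Omega : measurableType dO) (R : realType).
Variables (Q : probability Omega R) (xi : nat -> {mfun Omega >-> Xi}).

(** A pi-system generating the events decided by the first k samples; for k = 0 it contains the
    whole space only. *)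
Definition past_cylinder (k : nat) : set (set Omega) :=
  [set A | exists2 C : nat -> set Xi, (forall i, measurable (C i)) &
    A = \bigcap_(i < k) xi i @^-1` C i].

Lemma past_cylinder_setI k : setI_closed (past_cylinder k).
Proof.
move=> _ _ [C mC ->] [D mD ->]; exists (fun i => C i `&` D i).
  by move=> i; exact: measurableI.
by apply/seteqP; split=> [t [Ct Dt] i ik|t H]; split=> [|//]; try move=> i ik;
  [exact: Ct|exact: Dt|case: (H _ ik)..].
Qed.

Lemma past_cylinderT k : past_cylinder k setT.
Proof.
exists (fun=> setT) => //; apply/seteqP; split=> // t _ i _; exact: I.
Qed.

Lemma past_cylinder_measurable k : past_cylinder k `<=` measurable.
Proof.
move=> _ [C mC ->]; apply: fin_bigcap_measurable; first exact: finite_II.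
by move=> i _; rewrite -[X in measurable X]setTI; exact: measurable_funP.
Qed.

Lemma past_cylinderS k : past_cylinder k `<=` past_cylinder k.+1.
Proof.
move=> _ [C mC ->]; exists (fun i => if (i < k)%N then C i else setT).
  by move=> i; case: ifP.
apply/seteqP; split=> t /= H i ik; first by case: ifPn => // /(H i).
by have := H i (leq_trans ik (leqnSn k)); rewrite (ik : (i < k)%N).
Qed.

(* The past is Omega itself with a coarser sigma-algebra, so that conditioning on
   it is Fubini's theorem for the law of om |-> (om, xi_k om) on past k * Xi. *)
Definition past k := g_sigma_algebraType (past_cylinder k).

Lemma past_measurable k (A : set Omega) :
  measurable (A : set (past k)) -> measurable A.
Proof.
by apply: smallest_sub; [exact: sigma_algebra_measurable|
  exact: past_cylinder_measurable].
Qed.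

Lemma past_measurableS k (A : set Omega) :
  measurable (A : set (past k)) -> measurable (A : set (past k.+1)).
Proof.
by apply: smallest_sub; [exact: smallest_sigma_algebra|
  move=> B /past_cylinderS; exact: sub_sigma_algebra].
Qed.

Lemma measurable_fun_past d' (T : measurableType d') k (h : Omega -> T) :
  measurable_fun [set: past k] (h : past k -> T) -> measurable_fun setT h.
Proof. by move=> mh _ B mB; apply: past_measurable; exact: mh. Qed.

Lemma measurable_fun_pastS d' (T : measurableType d') k (h : Omega -> T) :
  measurable_fun [set: past k] (h : past k -> T) ->
  measurable_fun [set: past k.+1] (h : past k.+1 -> T).
Proof. by move=> mh _ B mB; apply: past_measurableS; exact: mh. Qed.

Lemma measurable_fun_past_last k :
  measurable_fun [set: past k.+1] (xi k : past k.+1 -> Xi).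
Proof.
move=> _ B mB; rewrite setTI; apply: sub_sigma_algebra.
exists (fun i => if i == k then B else setT) => [i|]; first by case: ifP.
apply/seteqP; split=> t /=; last by move=> /(_ k (ltnSn k)); rewrite eqxx.
by move=> Bt i _; case: eqP => // ->.
Qed.

Hypothesis indep : mutually_independent Q xi.

(** For fixed B both sides are finite measures in A, and they agree on the generating pi-system of
    cylinders. *)
Lemma past_independent k (A : set Omega) (B : set Xi) :
  measurable (A : set (past k)) -> measurable B ->
  Q (A `&` xi k @^-1` B) = (Q A * Q (xi k @^-1` B))%E.
Proof.
move=> mA mB; have mxB : measurable (xi k @^-1` B).
  by rewrite -[X in measurable X]setTI; exact: measurable_funP.
pose r := NngNum (fine_ge0 (measure_ge0 Q (xi k @^-1` B))).
have rE : r%:num%:E = Q (xi k @^-1` B) by rewrite /= fineK// fin_num_measure.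
suff : mrestr Q mxB A = mscale r Q A.
  by rewrite /mrestr /mscale rE muleC.
apply: (@g_sigma_algebra_measure_unique _ R Omega (past_cylinder k)
  (@past_cylinder_measurable k) (fun=> setT)) => //.
- by move=> _; exact: past_cylinderT.
- by apply/seteqP; split => // t _; exists 0%N.
- exact: past_cylinder_setI.
- move=> _ [C mC ->]; rewrite /= /mrestr /mscale [X in (X * _)%E]rE.
  (* Independence is applied to the indices below k and to these together with k, where [C'] carries
     B at index k. *)
  pose J := [fset i in iota 0 k]%fset.
  have JE i : (i \in J) = (i < k)%N by rewrite !inE mem_iota.
  pose C' i := if i == k then B else C i.
  have mC' i : measurable (C' i) by rewrite /C'; case: ifP.
  have := indep J mC; have := indep (k |` J)%fset mC'.
  have kJ : k \notin J by rewrite JE ltnn.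
  have C'k : C' k = B by rewrite /C' eqxx.
  rewrite big_fsetU1//= C'k.
  have -> : (\prod_(i <- J) Q (xi i @^-1` C' i) =
      \prod_(i <- J) Q (xi i @^-1` C i))%E.
    apply: eq_big_seq => i iJ; rewrite /C'; case: eqP => // ik.
    by move: kJ; rewrite -ik iJ.
  have JI D : \bigcap_(i in [set` J]) xi i @^-1` D i =
      \bigcap_(i < k) xi i @^-1` D i.
    by rewrite (_ : [set` J] = `I_k)//; apply/seteqP; split=> i /=; rewrite JE.
  rewrite JI => H1 H2; rewrite H2 -H1; congr (Q _).
  apply/seteqP; split=> t /=.
    move=> [Ct Bt] i; rewrite /mkset in_fset1U => /orP[/eqP ->|].
      by rewrite C'k.
    by rewrite JE /preimage /C' => ik; rewrite lt_eqF//; exact: Ct.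
  move=> Ct; split.
    move=> i /= ik; have := Ct i; rewrite /mkset in_fset1U JE ik orbT.
    by move=> /(_ isT); rewrite /preimage /C' lt_eqF.
  by have := Ct k; rewrite /mkset in_fset1U eqxx /preimage C'k; exact.
- by move=> _; rewrite /= /mrestr setTI (le_lt_trans (probability_le1 Q mxB))// ltry.
Qed.

End Past.

(* Unlike [le_integral] and [ge0_le_integral], no measurability is needed: the
   library integral of the positive part is a supremum over simple functions. *)
Lemma le_integral_setT d (T : measurableType d) (R : realType)
    (mu : {measure set T -> \bar R}) (f1 f2 : T -> \bar R) :
  (forall t, f1 t <= f2 t)%E -> (\int[mu]_t f1 t <= \int[mu]_t f2 t)%E.
Proof.
move=> f12; rewrite integralE [leRHS]integralE.
have pos t : (f1^\+ t <= f2^\+ t)%E.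
  by apply: (@funepos_le _ _ setT) => [u _|]; [exact: f12|rewrite inE].
have neg t : (f2^\- t <= f1^\- t)%E.
  by apply: (@funeneg_le _ _ setT) => [u _|]; [exact: f12|rewrite inE].
by apply: leeB; rewrite !ge0_integralTE//; apply: ereal_sup_le => _ [h hf <-];
  exists h => // t; apply: le_trans (hf t) _.
Qed.

(** * Square-integrable random variables *)

Section SquareIntegrable.
Context d (T : measurableType d) (R : realType) (Q : probability T R).
Implicit Types X Y : T -> R.

Definition sq_integrable X := measurable_fun setT X /\
  Q.-integrable setT (EFin \o (fun t => X t ^+ 2)).

Lemma sq_integrable_le X Y : measurable_fun setT X -> sq_integrable Y ->
  (forall t, `|X t| <= `|Y t|) -> sq_integrable X.
Proof.
move=> mX [mY iY] XY; split=> //; apply: le_integrable iY => //.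
  by apply/measurable_EFinP; exact: measurable_funX.
move=> t _ /=; rewrite lee_fin !normrX.
by rewrite lerXn2r ?nnegrE.
Qed.

Lemma sq_integrable_cst c : sq_integrable (cst c).
Proof.
by split=> //; exact: (finite_measure_integrable_cst Q (c ^+ 2)).
Qed.

Lemma sq_integrableZ c X : sq_integrable X -> sq_integrable (fun t => c * X t).
Proof.
move=> [mX iX]; split; first exact: measurable_funM.
apply: (eq_integrable _ (fun t => (c ^+ 2)%:E * (X t ^+ 2)%:E)%E) => //.
  by move=> t _ /=; rewrite -EFinM exprMn.
exact: integrableZl.
Qed.

Lemma sq_integrableD X Y : sq_integrable X -> sq_integrable Y ->
  sq_integrable (fun t => X t + Y t).
Proof.
move=> sX sY; have mXY := measurable_funD sX.1 sY.1; split=> //.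
(* The dominating function is 2 X^2 + 2 Y^2. *)
have /(integrableZl measurableT 2) iX := sX.2.
have /(integrableZl measurableT 2) iY := sY.2.
apply: le_integrable (integrableD measurableT iX iY) => //.
  by apply/measurable_EFinP; exact: measurable_funX.
move=> t _ /=; rewrite lee_fin ger0_norm ?sqr_ge0// ger0_norm.
  by have := sqr_ge0 (X t - Y t); rewrite sqrrB sqrrD; lra.
by have := sqr_ge0 (X t); have := sqr_ge0 (Y t); lra.
Qed.

Lemma sq_integrable_sum I (r : seq I) (X : I -> T -> R) :
  (forall i, sq_integrable (X i)) -> sq_integrable (fun t => \sum_(i <- r) X i t).
Proof.
move=> sX; elim: r => [|i r ih].
  by under eq_fun do rewrite big_nil; exact: sq_integrable_cst.
by under eq_fun do rewrite big_cons; exact: sq_integrableD.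
Qed.

(** The product is dominated by X^2 + Y^2. *)
Lemma sq_integrableM X Y : sq_integrable X -> sq_integrable Y ->
  Q.-integrable setT (fun t => (X t * Y t)%:E).
Proof.
move=> sX sY; apply: le_integrable (integrableD measurableT sX.2 sY.2) => //.
  by apply/measurable_EFinP; exact: measurable_funM sX.1 sY.1.
move=> t _ /=; rewrite lee_fin [leRHS]ger0_norm ?addr_ge0 ?sqr_ge0//.
rewrite normrM -(real_normK (num_real (X t))) -(real_normK (num_real (Y t))).
have := sqr_ge0 (`|X t| - `|Y t|).
have := sqr_ge0 (`|X t|); have := sqr_ge0 (`|Y t|).
rewrite sqrrB; nra.
Qed.

End SquareIntegrable.

(** * From extended-real to real-valued convex functions *)

Section FineConvexity.
Context {R : realType} {n : nat}.
Variable nrm : 'rV[R]_n -> R.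
Implicit Types (h g : 'rV[R]_n -> \bar R) (D E : set 'rV[R]_n).

Lemma dom_fineK h y : h y != -oo%E -> dom h y -> (fine (h y))%:E = h y.
Proof. by move=> hNy hy; rewrite fineK// fin_numE hNy/= lt_eqF. Qed.

(** The right side of the convexity inequality is finite, hence so is the left; this yields
    convexity of the domain together with the real inequality. *)
Lemma strongly_convex_on_fine D c h x y (t : R) : (forall y, h y != -oo%E) ->
  strongly_convex_on D nrm c h -> D x -> D y -> dom h x -> dom h y ->
  0 <= t <= 1 -> dom h (t *: x + (1 - t) *: y) /\
  fine (h (t *: x + (1 - t) *: y)) <= t * fine (h x) + (1 - t) * fine (h y)
    - c / 2 * t * (1 - t) * nrm (x - y) ^+ 2.
Proof.
move=> hNy hD Dx Dy /(dom_fineK (hNy x)) hx /(dom_fineK (hNy y)) hy t01.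
have := hD x y t Dx Dy t01.
rewrite -[in X in (_ <= X)%E]hx -[in X in (_ <= X)%E]hy.
rewrite -!EFinM -!EFinD => H.
have dxy : dom h (t *: x + (1 - t) *: y) by apply: le_lt_trans H (ltry _).
by split=> //; rewrite -lee_fin dom_fineK.
Qed.

Lemma argmin_minimizes E (phi : 'rV[R]_n -> \bar R) (h : 'rV[R]_n -> R) p :
  (forall y, dom phi y -> E y) -> (forall y, E y -> phi y = (h y)%:E) ->
  argmin phi p -> minimizes E h p.
Proof.
move=> dE phiE [dp pmin]; split; first exact: dE.
by move=> y Ey; rewrite -lee_fin -!phiE//; exact: dE.
Qed.

(** Without the value -oo nothing can cancel, so a sum below +oo with positive weights has all its
    terms below +oo. *)
Lemma dom_pos_combination (r b c : R) g h y : 0 < b -> 0 < c ->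
  g y != -oo%E -> h y != -oo%E ->
  (r%:E + (b%:E * g y + c%:E * h y) < +oo)%E -> dom g y /\ dom h y.
Proof.
move=> b0 c0; rewrite /dom /=.
by case: (g y) => [u| |]; case: (h y) => [v| |] //;
  rewrite ?gt0_muley ?lte_fin// ?ltxx// ?ltry.
Qed.

End FineConvexity.

(** * The prox map *)

Section ProxMap.
Context {R : realType} {n : nat}.
Variable nrm : 'rV[R]_n -> R.
Hypothesis nrmP : is_norm nrm.
Variables (g Psi : 'rV[R]_n -> \bar R) (sigma beta : R).
Hypotheses (gNy : forall y, g y != -oo%E) (sigma0 : 0 <= sigma)
  (gsc : strongly_convex_on (dom g) nrm sigma g)
  (prox : prox_function g nrm beta Psi).
Variables (a gamma : nat -> R).
Hypotheses (a0 : forall k, 0 < a k) (gamma0 : forall k, 0 < gamma k).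

Let PsiNy : forall y, Psi y != -oo%E. Proof. by case: prox. Qed.
Let beta0 : 0 < beta. Proof. by case: prox. Qed.

(** The effective domain of the prox objectives, the same at every stage because the weights are
    positive. *)
Definition prox_dom := dom g `&` dom Psi.

Let obj := prox_objective (fine \o g) (fine \o Psi) a gamma.

Lemma prox_dom_convex : convex_domain prox_dom.
Proof.
move=> x y t [gx px] [gy py] t01; split.
  by have [] := strongly_convex_on_fine gNy gsc gx gy gx gy t01.
by case: prox => _ _ _ psc _;
  have [] := strongly_convex_on_fine PsiNy psc gx gy px py t01.
Qed.

Lemma fine_g_strongly_convex : strongly_convex_real nrm prox_dom sigma (fine \o g).
Proof.
move=> x y t [gx px] [gy py] t01.
by have [] := strongly_convex_on_fine gNy gsc gx gy gx gy t01.
Qed.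

Lemma fine_Psi_strongly_convex : strongly_convex_real nrm prox_dom beta (fine \o Psi).
Proof.
move=> x y t [gx px] [gy py] t01; case: prox => _ _ _ psc _.
by have [] := strongly_convex_on_fine PsiNy psc gx gy px py t01.
Qed.

Lemma fine_Psi_ge0 y : prox_dom y -> 0 <= fine (Psi y).
Proof. by case: prox => _ P0 _ _ _ [gy _]; rewrite fine_ge0// P0. Qed.

Lemma argmin_prox_objective k s p :
  argmin (fun y => (dot s y)%:E + (Asum a k)%:E * g y
                     + (gamma k)%:E * Psi y)%E p ->
  minimizes prox_dom (obj k s) p.
Proof.
apply: argmin_minimizes => [y|y [gy py]].
  by rewrite /dom /= -addeA => /dom_pos_combination; apply => //; exact: Asum_gt0.
rewrite -(dom_fineK (gNy y) gy) -(dom_fineK (PsiNy y) py).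
by rewrite -!EFinM -!EFinD /obj /prox_objective /= addrA.
Qed.

(** The solvability clause of [prox_function] gives [g] weight one, so it is applied to the
    objective divided by A_k. *)
Lemma prox_objective_minimizer k s : exists p, minimizes prox_dom (obj k s) p.
Proof.
have A0 := Asum_gt0 a0 k.
case: prox => _ _ _ _ /(_ ((Asum a k)^-1 *: s) (gamma k / Asum a k)).
case=> [|p pmin]; first by rewrite divr_gt0.
exists p.
have [Ep H] : minimizes prox_dom (fun y => (Asum a k)^-1 * obj k s y) p.
  apply: argmin_minimizes pmin => [y|y [gy py]].
    rewrite /dom /= -addeA -[X in (_ + (X + _))%E]mul1e => /dom_pos_combination.
    by apply => //; rewrite divr_gt0.
  rewrite -(dom_fineK (gNy y) gy) -(dom_fineK (PsiNy y) py).
  rewrite -!EFinM -!EFinD /obj /prox_objective /= dotZl; congr (_%:E).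
  by field; rewrite gt_eqF.
by split=> // y Ey; have := H y Ey; rewrite ler_pM2l// invr_gt0.
Qed.

(** One constant per stage, in coordinates; it serves uniqueness, continuity and square
    integrability of the stage minimizers. *)
Lemma minimizer_sup_lipschitz k : exists2 K, 0 <= K &
  forall s s' p p', minimizes prox_dom (obj k s) p ->
    minimizes prox_dom (obj k s') p' ->
    `|p - p'| <= K * \sum_(i < n) `|s 0 i - s' 0 i|.
Proof.
have [K1 K10 HK1] := sup_le_nrm nrmP; have [K2 K20 HK2] := dual_norm_le nrmP.
have mu0 := mu_gt0 sigma0 beta0 a0 gamma0 k.
exists (K1 * (K2 / mu_ a gamma sigma beta k)).
  by rewrite mulr_ge0 ?divr_ge0// ltW.
move=> s s' p p' mp mp'.
apply: le_trans (HK1 _) _; rewrite -!mulrA ler_pM2l//.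
have := minimizer_lipschitz nrmP mu0 prox_dom_convex
  (prox_objective_strongly_convex fine_g_strongly_convex
     fine_Psi_strongly_convex a0 gamma0 k) mp mp'.
move=> /le_trans; apply; rewrite mulrCA mulrC ler_pM2l ?invr_gt0//.
apply: le_trans (HK2 _) _; rewrite ler_pM2l//.
by apply: ler_sum => i _; rewrite !mxE.
Qed.

(** A minimizer always exists, so the default 0 of [xget] is never a fallback. *)
Definition prox_map k s := xget 0 [set p | minimizes prox_dom (obj k s) p].

Lemma prox_mapP k s : minimizes prox_dom (obj k s) (prox_map k s).
Proof.
have [p mp] := prox_objective_minimizer k s.
by rewrite /prox_map; case: xgetP => [_ _ //|/(_ p)].
Qed.

(** Uniqueness is the Lipschitz bound for two equal dual variables. *)
Lemma minimizes_prox_map k s p : minimizes prox_dom (obj k s) p ->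
  p = prox_map k s.
Proof.
move=> mp; have [K K0 H] := minimizer_sup_lipschitz k.
have := H _ _ _ _ mp (prox_mapP k s).
rewrite big1 ?mulr0; last by move=> i _; rewrite subrr normr0.
by rewrite normr_le0 subr_eq0 => /eqP.
Qed.

Lemma prox_map_continuous k : continuous (prox_map k).
Proof.
have [K K0 H] := minimizer_sup_lipschitz k.
apply: (@lipschitz_continuous_bound _ _ _ _ (K * n%:R)) => s s'.
apply: le_trans (H _ _ _ _ (prox_mapP k s) (prox_mapP k s')) _.
rewrite -mulrA ler_wpM2l//; apply: le_trans (sum_coord_le_norm _).
by apply: ler_sum => i _; rewrite !mxE.
Qed.

End ProxMap.

(** * Integrable variables with a given mean *)

Section HasMean.
Context d (T : measurableType d) (R : realType) (Q : probability T R).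
Implicit Types (X Y : T -> R) (c m : R).

Definition has_mean X m := Q.-integrable setT (EFin \o X) /\
  (\int[Q]_t (X t)%:E = m%:E)%E.

Lemma has_mean_cst c : has_mean (cst c) c.
Proof.
split; first exact: (finite_measure_integrable_cst Q c).
by have := expectation_cst Q c; rewrite unlock.
Qed.

Lemma has_meanD X Y m1 m2 : has_mean X m1 -> has_mean Y m2 ->
  has_mean (fun t => X t + Y t) (m1 + m2).
Proof.
move=> [iX mX] [iY mY]; split; first exact: (integrableD measurableT iX iY).
by under eq_integral do rewrite EFinD; rewrite integralD_EFin// mX mY.
Qed.

Lemma has_meanZ c X m : has_mean X m -> has_mean (fun t => c * X t) (c * m).
Proof.
move=> [iX mX]; split; first exact: (integrableZl measurableT c iX).
by under eq_integral do rewrite EFinM; rewrite integralZl// mX.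
Qed.

Lemma has_mean_sum k (X : nat -> T -> R) (m : nat -> R) :
  (forall i, (i < k)%N -> has_mean (X i) (m i)) ->
  has_mean (fun t => \sum_(i < k) X i t) (\sum_(i < k) m i).
Proof.
elim: k => [|k ih] Xm.
  by rewrite big_ord0; under eq_fun do rewrite big_ord0; exact: has_mean_cst.
rewrite big_ord_recr /=; under eq_fun do rewrite big_ord_recr /=.
by apply: has_meanD; [apply: ih => i ik; apply: Xm; exact: ltnW|exact: Xm].
Qed.

Lemma has_mean_sum0 (I : Type) (r : seq I) (X : I -> T -> R) :
  (forall i, has_mean (X i) 0) -> has_mean (fun t => \sum_(i <- r) X i t) 0.
Proof.
move=> X0; elim: r => [|i r ih].
  by under eq_fun do rewrite big_nil; exact: has_mean_cst.
under eq_fun do rewrite big_cons.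
by have := has_meanD (X0 i) ih; rewrite addr0.
Qed.

End HasMean.

(** * Expectations along the method *)

Section RQMIterates.
Context {R : realType} {n : nat} {dX dO : measure_display}
  {Xi : measurableType dX} {Omega : measurableType dO}.
Variables (P : probability Xi R) (Q : probability Omega R).
Variable nrm : 'rV[R]_n -> R.
Hypothesis nrmP : is_norm nrm.
Variables (fbar g Psi : 'rV[R]_n -> \bar R) (sigma beta : R).
Hypotheses (gNy : forall y, g y != -oo%E) (cg : closed (dom g))
  (sigma0 : 0 <= sigma) (gsc : strongly_convex_on (dom g) nrm sigma g)
  (prox : prox_function g nrm beta Psi).
Variable w : 'rV[R]_n -> Xi -> 'rV[R]_n.
Hypothesis wP : stochastic_subgradient P (dom g) fbar w.
Variables (a gamma : nat -> R).
Hypotheses (a0 : forall k, 0 < a k) (gamma0 : forall k, 0 < gamma k).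
Variable xi : nat -> {mfun Omega >-> Xi}.
Hypothesis xiP : independent_copies P Q xi.
Variables s x xplus : nat -> Omega -> 'rV[R]_n.
Hypothesis rqm : RQM g Psi a gamma w (fun k => xi k) s x xplus.

(* The minimizer at stage k: x_0 for k = 0 and x_(k-1)^+ for k > 0. *)
Definition stage_minimizer k := if k is l.+1 then xplus l else x 0%N.

Let E := prox_dom g Psi.
Let T := prox_map g Psi a gamma.
Let z := stage_minimizer.

Let beta0 : 0 < beta. Proof. by case: prox. Qed.
Let cE : convex_domain E. Proof. exact: prox_dom_convex gNy gsc prox. Qed.

(** The initial point counts as a stage because its dual variable is 0 and the linear term
    vanishes. *)
Lemma stage_minimizerP k om :
  minimizes E (prox_objective (fine \o g) (fine \o Psi) a gamma k (s k om))
    (z k om).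
Proof.
apply: (argmin_prox_objective gNy prox a0 gamma0).
case: k => [|k]; last exact: rqm_xplus rqm k om.
have := rqm_init_x rqm om; rewrite (rqm_init_s rqm om).
suff -> : (fun y => (dot 0 y)%:E + (Asum a 0)%:E * g y
    + (gamma 0)%:E * Psi y)%E =
  (fun y => (Asum a 0)%:E * g y + (gamma 0)%:E * Psi y)%E by [].
by apply/funext => y; rewrite dot0l add0e.
Qed.

Lemma stage_minimizerE k om : z k om = T k (s k om).
Proof.
exact: (minimizes_prox_map nrmP gNy sigma0 gsc prox a0 gamma0
  (stage_minimizerP k om)).
Qed.

Lemma rqm_averaging k om : x k.+1 om =
  (Asum a k / Asum a k.+1) *: x k om + (a k.+1 / Asum a k.+1) *: z k.+1 om.
Proof. exact: rqm_x rqm k om. Qed.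

Lemma rqm_iterate_dom k om : E (x k om).
Proof.
exact: (iterate_dom cE a0 (s := s ^~ om) (z := z ^~ om) (x := x ^~ om)
  (fun k => stage_minimizerP k om) erefl (fun k => rqm_averaging k om)).
Qed.

(** The source space is left general: it will be [Omega], the past, and the product of the past with
    [Xi]. *)
Lemma measurable_oracle d' (T' : measurableType d') (h : T' -> 'rV[R]_n)
    (zeta : T' -> Xi) i :
  (forall j, measurable_fun setT (fun t => h t 0 j)) ->
  measurable_fun setT zeta -> (forall t, dom g (h t)) ->
  measurable_fun setT (fun t => w (h t) (zeta t) 0 i).
Proof.
move=> mh mzeta hg; case: wP => mw _ _ _.
apply: (@measurable_comp _ _ _ _ _ _
  [set p : borel_rV R n * Xi | dom g p.1]
  (fun p : borel_rV R n * Xi => w p.1 p.2 0 i) setT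
  (fun t => (h t : borel_rV R n, zeta t))).
(* Closedness of [dom g] makes the domain of joint measurability a Borel set. *)
- rewrite -[X in measurable X]setTI.
  by apply: (@measurable_fst _ _ (borel_rV R n) Xi) => //; exact: closed_borel_rV.
- by move=> _ [t _ <-] /=; exact: hg.
- exact: mw.
- by apply: measurable_fun_pair => //; exact: measurable_fun_borel_rV.
Qed.

Definition adapted k (h : Omega -> 'rV[R]_n) := forall i,
  measurable_fun [set: past xi k] (fun om : past xi k => h om 0 i).

Lemma adapted_prox_map k : adapted k (s k) -> adapted k (z k).
Proof.
move=> ms i.
rewrite (_ : (fun om => z k om 0 i) =
  ((fun y : borel_rV R n => (y : 'rV[R]_n) 0 i) \o
    ((T k : borel_rV R n -> borel_rV R n) \o (s k : past xi k -> borel_rV R n)))).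
  apply: measurableT_comp; first exact: coord_borel_fun.
  apply: measurableT_comp; last exact: measurable_fun_borel_rV.
  apply: continuous_borel_rV_fun.
  exact: (prox_map_continuous nrmP gNy sigma0 gsc prox a0 gamma0).
by apply/funext => om /=; rewrite stage_minimizerE.
Qed.

(** The induction is joint: s_(k+1) queries the oracle at x_k, and x_(k+1) is built from the
    minimizer for s_(k+1). *)
Lemma rqm_adapted k : adapted k (s k) /\ adapted k (x k).
Proof.
elim: k => [|k [ms mx]].
  have ms : adapted 0 (s 0%N).
    by move=> i; under eq_fun do rewrite (rqm_init_s rqm) mxE; exact: measurable_cst.
  by split=> //; exact: adapted_prox_map ms.
have ms1 : adapted k.+1 (s k.+1).
  move=> i; under eq_fun do rewrite (rqm_s rqm) !mxE.
  apply: measurable_funD; first exact: measurable_fun_pastS (ms i).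
  apply: measurable_funM => //; apply: measurable_oracle.
  - by move=> j; exact: measurable_fun_pastS (mx j).
  - exact: measurable_fun_past_last.
  - by move=> om; case: (rqm_iterate_dom k om).
split=> // i; under eq_fun do rewrite rqm_averaging !mxE.
apply: measurable_funD; apply: measurable_funM => //.
  exact: measurable_fun_pastS (mx i).
exact: adapted_prox_map ms1 i.
Qed.

Let mz k i : measurable_fun [set: past xi k] (fun om : past xi k => z k om 0 i).
Proof. by apply: adapted_prox_map; case: (rqm_adapted k). Qed.

Let mw k i : measurable_fun setT (fun om => w (x k om) (xi k om) 0 i).
Proof.
apply: measurable_oracle => //.
  by move=> j; apply: (@measurable_fun_past _ _ _ _ xi _ _ k); case: (rqm_adapted k).
by move=> om; case: (rqm_iterate_dom k om).
Qed.

Lemma measurable_dual_norm_oracle k :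
  measurable_fun setT (fun om => dual_norm nrm (w (x k om) (xi k om))).
Proof.
apply: (@measurableT_comp _ _ _ _ _ _ (dual_norm nrm : borel_rV R n -> R) _
  (fun om => w (x k om) (xi k om))).
  by apply: continuous_borel_fun; exact: dual_norm_continuous.
exact: measurable_fun_borel_rV.
Qed.

Let sqD k := sq_integrable Q (fun om => dual_norm nrm (w (x k om) (xi k om))).

Lemma sq_integrable_oracle k i : sqD k ->
  sq_integrable Q (fun om => w (x k om) (xi k om) 0 i).
Proof.
move=> /(sq_integrableZ (nrm (delta_mx 0 i))) sD; apply: sq_integrable_le sD _ => //.
move=> om; apply: le_trans (ler_coord_dual_norm nrmP _ _) _.
by rewrite mulrC ler_norm.
Qed.

Lemma sq_integrable_dual_variable k i : (forall l, (l < k)%N -> sqD l) ->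
  sq_integrable Q (fun om => s k om 0 i).
Proof.
elim: k => [|k ih] sD.
  under eq_fun do rewrite (rqm_init_s rqm) mxE; exact: sq_integrable_cst.
under eq_fun do rewrite (rqm_s rqm) !mxE.
apply: sq_integrableD; first by apply: ih => l lk; apply: sD; exact: ltnW.
by apply: sq_integrableZ; apply: sq_integrable_oracle; exact: sD.
Qed.

(** The Lipschitz bound compares z_k with the deterministic minimizer for dual variable 0, so z_k
    grows at most linearly in the dual variable. *)
Lemma sq_integrable_stage_minimizer k i : (forall l, (l < k)%N -> sqD l) ->
  sq_integrable Q (fun om => z k om 0 i).
Proof.
move=> sD.
have [K K0 H] := minimizer_sup_lipschitz nrmP gNy sigma0 gsc prox a0 gamma0 k.
have sK : sq_integrable Q (fun om => `|T k 0 0 i| + K * \sum_(j < n) `|s k om 0 j|).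
  apply: sq_integrableD; first exact: sq_integrable_cst.
  apply: sq_integrableZ; apply: sq_integrable_sum => j.
  have sj := sq_integrable_dual_variable j sD.
  apply: sq_integrable_le (sj) _ => [|om]; last by rewrite normr_id.
  by apply: measurableT_comp => //; case: sj.
apply: sq_integrable_le sK _ => [|om].
  by apply: (@measurable_fun_past _ _ _ _ xi _ _ k); exact: mz.
rewrite [leRHS]ger0_norm; last by rewrite addr_ge0// mulr_ge0// sumr_ge0.
rewrite stage_minimizerE.
have -> : T k (s k om) 0 i = T k 0 0 i + (T k (s k om) - T k 0) 0 i.
  by rewrite !mxE addrC subrK.
apply: le_trans (ler_normD _ _) _; rewrite lerD2l.
apply: le_trans (ler_coord_norm _ _) _.
apply: le_trans (H _ _ _ _ (prox_mapP gNy prox a0 gamma0 k (s k om))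
  (prox_mapP gNy prox a0 gamma0 k 0)) _.
by rewrite ler_wpM2l//; apply: ler_sum => j _; rewrite mxE subr0.
Qed.

(** The conditional mean of the sampled subgradient given the past: [x k om] is frozen and only the
    fresh sample is averaged. *)
Let G k om := expected_vec P (w (x k om)).

Section Noise.
Variables (k : nat) (i : 'I_n) (u : Omega -> R).
Hypothesis mu : measurable_fun [set: past xi k] (u : past xi k -> R).
Hypothesis iwu : Q.-integrable setT (fun om => (w (x k om) (xi k om) 0 i * u om)%:E).

Let midm : measurable_fun setT (fun om : Omega => om : past xi k).
Proof.
by move=> _ A mA; rewrite setTI; exact: (@past_measurable _ _ _ _ xi k A mA).
Qed.

Let idm : {mfun Omega >-> past xi k} :=
  HB.pack (fun om : Omega => om : past xi k)
    (isMeasurableFun.Build _ _ _ _ _ midm).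

Let phi (p : past xi k * Xi) : \bar R := (w (x k p.1) p.2 0 i * u p.1)%:E.

Let mphi : measurable_fun setT phi.
Proof.
apply/measurable_EFinP; apply: measurable_funM.
  apply: measurable_oracle => //; last by move=> p; case: (rqm_iterate_dom k p.1).
  move=> j; apply: (@measurableT_comp _ _ _ _ _ _
    (fun om : past xi k => x k om 0 j)) => //.
  by case: (rqm_adapted k) => _; exact.
exact: measurableT_comp.
Qed.

Let indep A B : measurable A -> measurable B ->
  Q (idm @^-1` A `&` xi k @^-1` B) = (Q (idm @^-1` A) * P B)%E.
Proof.
move=> mA mB; case: xiP => mi ic; rewrite -(ic k B mB).
exact: past_independent.
Qed.

(** For a frozen past, u is a constant factor and the rest is a coordinate of the oracle's mean. *)
Let phiE om : (\int[P]_zeta phi (om, zeta))%E = (G k om 0 i * u om)%:E.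
Proof.
have gx : dom g (x k om) by case: (rqm_iterate_dom k om).
case: wP => _ iw _ _; have {}iw := iw _ gx i.
rewrite /phi /=; under eq_integral do rewrite EFinM.
rewrite integralZr// EFinM /G mxE unlock fineK//.
exact: integrable_fin_num.
Qed.

Lemma integrable_conditional_mean :
  Q.-integrable setT (fun om => (G k om 0 i * u om)%:E).
Proof.
have := @integrable_indep _ _ _ _ _ _ _ Q P idm (xi k) indep phi mphi iwu.
by apply: eq_integrable => // om _; exact: phiE.
Qed.

(** The tower property: u is decided by the past, which is independent of [xi k]. *)
Lemma integral_conditional_mean :
  (\int[Q]_om (w (x k om) (xi k om) 0 i * u om)%:E =
   \int[Q]_om (G k om 0 i * u om)%:E)%E.
Proof.
have := @integral_indep _ _ _ _ _ _ _ Q P idm (xi k) indep phi mphi iwu.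
by move=> ->; apply: eq_integral => om _; exact: phiE.
Qed.

End Noise.

Variable xs : 'rV[R]_n.

(** In each coordinate the sampled subgradient and its conditional mean have the same integral m
    against u, which is past-measurable; integrability of the first product comes from square
    integrability, that of the second from Fubini's theorem. *)
Lemma noise_mean0 l : sqD l -> (forall j, (j < l)%N -> sqD j) ->
  has_mean Q (fun om => dot (G l om - w (x l om) (xi l om)) (z l om - xs)) 0.
Proof.
move=> sl slt; apply: has_mean_sum0 => i.
pose u om := z l om 0 i - xs 0 i.
have su : sq_integrable Q u.
  apply: sq_integrableD; last exact: sq_integrable_cst.
  exact: sq_integrable_stage_minimizer.
have mu : measurable_fun [set: past xi l] (u : past xi l -> R).
  by apply: measurable_funB => //; exact: mz.
have iwu := sq_integrableM (sq_integrable_oracle i sl) su.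
have iGu := integrable_conditional_mean mu iwu.
have fGu := integrable_fin_num measurableT iGu.
set m := fine (\int[Q]_om (G l om 0 i * u om)%:E)%E.
have Gm : has_mean Q (fun om => G l om 0 i * u om) m.
  by split=> //; rewrite /m fineK.
have wm : has_mean Q (fun om => w (x l om) (xi l om) 0 i * u om) m.
  by split=> //; rewrite (integral_conditional_mean mu iwu) /m fineK.
have := has_meanD Gm (has_meanZ (-1) wm); rewrite mulN1r subrr.
suff -> : (fun om => G l om 0 i * u om + -1 * (w (x l om) (xi l om) 0 i * u om)) =
  (fun om => (G l om - w (x l om) (xi l om)) 0 i * (z l om - xs) 0 i) by [].
by apply/funext => om; rewrite /u !mxE; ring.
Qed.

Hypotheses (fbarNy : forall y, fbar y != -oo%E)
  (gammaS : forall k, gamma k <= gamma k.+1) (Exs : E xs).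

Let fr := fine \o fbar.

Lemma subgradient_fine k om y : E y ->
  fr (x k om) + dot (G k om) (y - x k om) <= fr y.
Proof.
move=> [gy _]; case: wP => _ _ _ sub.
(* A subgradient exists at y itself, and subdifferentials are empty off the effective domain, so
   [fbar y] is finite. *)
have [dy _] := sub _ gy.
have [dx /(_ y)] := sub _ (rqm_iterate_dom k om).1.
rewrite -(dom_fineK (fbarNy y) dy) -(dom_fineK (fbarNy (x k om)) dx).
by rewrite -EFinD lee_fin.
Qed.

Lemma iterate_value k om :
  (fbar (x k om) + g (x k om) = (fr (x k om) + fine (g (x k om)))%:E)%E.
Proof.
have [gx _] := rqm_iterate_dom k om.
case: wP => _ _ _ /(_ _ gx) [fx _].
by rewrite EFinD !dom_fineK.
Qed.

Lemma expected_value_le k (e : nat -> R) :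
  (forall l, (l <= k)%N ->
    'E_Q[fun om => (dual_norm nrm (w (x l om) (xi l om)) ^+ 2)%R]%E = (e l)%:E) ->
  (\int[Q]_om (fbar (x k om) + g (x k om)) <=
    ((Asum a k)^-1 * (Asum a k * (fr xs + fine (g xs))
       + gamma k * fine (Psi xs)
       + 2^-1 * \sum_(l < k.+1) a l ^+ 2 / mu_ a gamma sigma beta l * e l))%:E)%E.
Proof.
move=> eE; have A0 := Asum_gt0 a0 k.
have mD l := measurable_dual_norm_oracle l.
have De l : (l <= k)%N -> has_mean Q
    (fun om => dual_norm nrm (w (x l om) (xi l om)) ^+ 2) (e l).
  move=> lk; have := eE l lk; rewrite unlock => DE; split=> //.
  apply/integrableP; split.
    by apply/measurable_EFinP; apply: measurable_funX; exact: mD.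
  under eq_integral do rewrite gee0_abs ?lee_fin ?sqr_ge0//.
  by rewrite /= DE ltry.
have sq l : (l <= k)%N -> sqD l by move=> lk; split; [exact: mD|case: (De l lk)].
(* Y is the right side of [pathwise_bound] divided by A_k; its noise terms have mean zero. *)
pose Y om := (Asum a k)^-1 * (Asum a k * (fr xs + fine (g xs))
    + gamma k * fine (Psi xs)
    + 2^-1 * \sum_(l < k.+1) a l ^+ 2 / mu_ a gamma sigma beta l *
        dual_norm nrm (w (x l om) (xi l om)) ^+ 2
    + \sum_(l < k.+1) a l * dot (G l om - w (x l om) (xi l om)) (z l om - xs)).
have [_ <-] : has_mean Q Y ((Asum a k)^-1 * (Asum a k * (fr xs + fine (g xs))
    + gamma k * fine (Psi xs)
    + 2^-1 * \sum_(l < k.+1) a l ^+ 2 / mu_ a gamma sigma beta l * e l)).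
  apply: has_meanZ; rewrite -[X in has_mean _ _ X]addr0; apply: has_meanD.
    apply: has_meanD; first exact: has_mean_cst.
    apply: has_meanZ; apply: (has_mean_sum
      (X := fun l om => a l ^+ 2 / mu_ a gamma sigma beta l *
         dual_norm nrm (w (x l om) (xi l om)) ^+ 2)
      (m := fun l => a l ^+ 2 / mu_ a gamma sigma beta l * e l)) => l lk.
    by apply: has_meanZ; exact: De.
  have := @has_mean_sum _ _ _ Q k.+1
    (fun l om => a l * dot (G l om - w (x l om) (xi l om)) (z l om - xs))
    (fun=> 0).
  rewrite big1//; apply => l lk.
  have := has_meanZ (a l) (@noise_mean0 l (sq l lk) _); rewrite mulr0; apply.
  by move=> j jl; apply: sq; exact: leq_trans (ltnW jl) lk.
apply: le_integral_setT => om; rewrite iterate_value lee_fin.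
rewrite ler_pdivlMl//.
exact: (pathwise_bound nrmP cE sigma0 beta0
  (fine_g_strongly_convex gNy gsc) (fine_Psi_strongly_convex prox)
  (fine_Psi_ge0 prox) a0 gamma0 gammaS Exs
  (s := s ^~ om) (x := x ^~ om) (z := z ^~ om)
  (w := fun l => w (x l om) (xi l om)) (G := G ^~ om) (f := fr)
  (rqm_init_s rqm om) (fun l => rqm_s rqm l om)
  (fun l => stage_minimizerP l om) erefl (fun l => rqm_averaging l om)
  (fun l y => @subgradient_fine l om y) k).
Qed.

End RQMIterates.

(** * The bound in expectation, including infinite values *)

Theorem theorem1 (R : realType) (n : nat)
  (dX dO : measure_display)
  (Xi : measurableType dX) (P : probability Xi R)
  (Omega : measurableType dO) (Q : probability Omega R)
  (nrm : 'rV[R]_n -> R)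
  (f : 'rV[R]_n -> Xi -> \bar R) (g Psi : 'rV[R]_n -> \bar R)
  (sigma beta : R)
  (w : 'rV[R]_n -> Xi -> 'rV[R]_n)
  (a gamma : nat -> R)
  (xi : nat -> {mfun Omega >-> Xi})
  (s x xplus : nat -> Omega -> 'rV[R]_n)
  (xstar : 'rV[R]_n) :
  let fbar := expected_fun P f in
  let F := (fun y => fbar y + g y)%E in
  is_norm nrm ->
  (forall y z, f y z != -oo%E) ->
  (forall y, measurable_fun [set: Xi] (f y)) ->
  (forall z, closed_fun (f^~ z)) -> (forall z, convex_fun (f^~ z)) ->
  (forall y, fbar y != -oo%E) -> closed_fun fbar -> convex_fun fbar ->
  (forall y, g y != -oo%E) -> closed_fun g -> convex_fun g ->
  closed (dom g) ->
  0 <= sigma -> strongly_convex_on (dom g) nrm sigma g ->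
  {ae P, forall z, dom (f^~ z) `<=` dom g} ->
  stochastic_subgradient P (dom g) fbar w ->
  prox_function g nrm beta Psi ->
  (forall k, 0 < a k) -> (forall k, 0 < gamma k) ->
  (forall k, gamma k <= gamma k.+1) ->
  independent_copies P Q xi ->
  RQM g Psi a gamma w (fun k => xi k) s x xplus ->
  dom g xstar -> argmin F xstar ->
  forall k : nat,
    (\int[Q]_om F (x k om) - F xstar <=
       (gamma k / Asum a k)%:E * Psi xstar
       + B_ Q nrm a gamma sigma beta w (fun l => xi l) x k
         * ((Asum a k)^-1)%:E)%E.
Proof.
move=> fbar F nrmP _ _ _ _ fbarNy _ _ gNy _ _ cg sigma0 gsc _ wP prox a0 gamma0.
move=> gammaS xiP rqm gxs _ k.
have A0 := Asum_gt0 a0 k.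
have beta0 : 0 < beta by case: prox.
have PsiNy : forall y, Psi y != -oo%E by case: prox.
pose e l := 'E_Q[fun om => (dual_norm nrm (w (x l om) (xi l om)) ^+ 2)%R]%E.
have e0 l : (0 <= e l)%E by apply: expectation_ge0 => om; exact: sqr_ge0.
have c0 l : 0 < a l ^+ 2 / mu_ a gamma sigma beta l.
  by rewrite divr_gt0 ?exprn_gt0//; exact: mu_gt0.
have t0 l : (0 <= (a l ^+ 2 / mu_ a gamma sigma beta l)%:E * e l)%E.
  by rewrite mule_ge0// lee_fin ltW.
have B0 : (0 <= B_ Q nrm a gamma sigma beta w (fun l => xi l) x k)%E.
  by rewrite mule_ge0 ?lee_fin// sume_ge0.
(* If [Psi xstar] is +oo, so is the right side: the [B_] term is nonnegative and cannot cancel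
   it. *)
have [pxs|] := boolP (Psi xstar < +oo)%E; last first.
  rewrite ltey negbK => /eqP ->.
  rewrite gt0_muley ?lte_fin ?divr_gt0// addye ?leey//.
  by rewrite -ltNye (lt_le_trans ltNy0)// mule_ge0// lee_fin invr_ge0 ltW.
(* An infinite second moment up to stage k makes [B_] infinite, since its weights are positive and
   its other terms nonnegative. *)
have [efin|einf] := pselect (forall l, (l <= k)%N -> (e l < +oo)%E); last first.
  have [l [lk el]] : exists l, (l <= k)%N /\ e l = +oo%E.
    apply: contrapT => H; apply: einf => l lk; rewrite ltey.
    by apply/eqP => el; apply: H; exists l.
  suff -> : B_ Q nrm a gamma sigma beta w (fun l => xi l) x k = +oo%E.
    rewrite gt0_mulye ?lte_fin ?invr_gt0// -(dom_fineK (PsiNy _) pxs) -EFinM.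
    by rewrite addey ?leey.
  rewrite /B_ (bigD1 (Ordinal (lk : (l < k.+1)%N)))//= -/(e l) el.
  rewrite gt0_muley ?lte_fin ?c0// addye ?gt0_muley ?lte_fin//.
  by rewrite -ltNye (lt_le_trans ltNy0)// sume_ge0// => i _; exact: t0.
have eE l : (l <= k)%N -> e l = (fine (e l))%:E.
  by move=> lk; rewrite fineK// ge0_fin_numE// efin.
(* The subgradient at [xstar] makes [F xstar] a real number, so it can be moved across the
   inequality. *)
have fxs : dom fbar xstar by case: wP => _ _ _ /(_ _ gxs) [].
have FE : F xstar = (fine (fbar xstar) + fine (g xstar))%:E.
  by rewrite EFinD !dom_fineK.
rewrite FE leeBlDr//.
apply: le_trans (expected_value_le nrmP gNy cg sigma0 gsc prox wP a0 gamma0 xiP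
  rqm fbarNy gammaS (conj gxs pxs) eE) _.
have -> : B_ Q nrm a gamma sigma beta w (fun l => xi l) x k =
    (2^-1 * \sum_(l < k.+1) a l ^+ 2 / mu_ a gamma sigma beta l * fine (e l))%:E.
  rewrite /B_ EFinM -sumEFin; congr (_ * _)%E; apply: eq_bigr => l _.
  by rewrite [RHS]EFinM -eE// -ltnS.
rewrite -(dom_fineK (PsiNy _) pxs) -!EFinM -!EFinD lee_fin.
rewrite le_eqVlt; apply/orP; left; apply/eqP.
by rewrite /=; field; rewrite gt_eqF.
Qed.
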